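(* Let $N\ge1$, $M\ge N$, $K=N+M$, $\sigma>0$, $\bm S_{\rm enc}\in{\rm Sp}(2K,\mathbb R)$, and let $\bm\Lambda_d\in{\rm Sp}(2N,\mathbb R)$, $\bm\Lambda_a\in{\rm Sp}(2M,\mathbb R)$, $G_1,\dots,G_N\ge1$ be such that $(\bm\Lambda_d\oplus\bm\Lambda_a)\bm S_{\rm enc}^{-1}\bm S_{\rm enc}^{-\top}(\bm\Lambda_d\oplus\bm\Lambda_a)^\top=\bm T_{\bm G}\bm T_{\bm G}^\top$. Let $\bm\xi\sim\mathcal N(0,\sigma^2\bm I_{2K})$ and $\bm y=(\bm y_d,\bm y_a)=(\bm\Lambda_d\oplus\bm\Lambda_a)\bm S_{\rm enc}^{-1}\bm\xi$ with $\bm y_d\in\mathbb R^{2N}$, $\bm y_a\in\mathbb R^{2M}$. Then for every measurable $\bm f:\mathbb R^{2M}\to\mathbb R^{2N}$, $$\mathbb E\big[\|\bm y_d-\bm f(\bm y_a)\|^2\big]\ \ge\ \sum_{i=1}^N\frac{2\sigma^2}{2G_i-1}.$$ Consequently, the residual data error of any Gaussian-encoded oscillator-to-oscillator code (with any ancilla state and any decoder, expressed in this frame) cannot be made arbitrarily small at bounded gains, regardless of the number $M$ of ancilla modes.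
   Context: Phase-space vectors ordered $(q_1,p_1,\dots)$; $\bm\Omega=\bigoplus\begin{pmatrix}0&1\\-1&0\end{pmatrix}$; ${\rm Sp}(2n,\mathbb R)=\{\bm S:\bm S\bm\Omega\bm S^\top=\bm\Omega\}$. The first $N$ modes are data modes, the last $M$ ancilla modes. $\bm S_G=\begin{pmatrix}\sqrt G\bm I_2&\sqrt{G-1}\bm Z\\ \sqrt{G-1}\bm Z&\sqrt G\bm I_2\end{pmatrix}$ with $\bm Z={\rm diag}(1,-1)$, $G\ge1$; $\bm T_{\bm G}\in{\rm Sp}(2K,\mathbb R)$ acts as $\bm S_{G_i}$ on the pair (data mode $i$, ancilla mode $i$) for $i\le N$ and as the identity on ancilla modes $N+1,\dots,M$. (Such $\bm\Lambda_d,\bm\Lambda_a,G_i$ always exist.) *)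

(* Defs.v *)
From HB Require Import structures.
From mathcomp Require Import all_boot all_order all_algebra.
From mathcomp Require Import all_classical all_reals all_analysis.
Set Implicit Arguments. Unset Strict Implicit. Unset Printing Implicit Defensive.
Import Order.TTheory GRing.Theory Num.Theory.
Local Open Scope ring_scope.

(* Phase-space vectors ordered (q_1,p_1,...,q_n,p_n), i.e. 0-indexed coordinate
   2k is q_{k+1} and 2k+1 is p_{k+1}.  For a dimension m (= 2n) the symplectic
   form Omega = (+) [[0,1],[-1,0]] has entries
   Omega_{a,a+1} = 1 for a even, Omega_{a,a-1} = -1 for a odd, 0 otherwise. *)
Definition Omega (R : pzRingType) (m : nat) : 'M[R]_m :=
  \matrix_(a < m, b < m)
    (if ~~ odd a && (nat_of_ord b == a.+1) then 1
     else if odd a && (nat_of_ord b == a.-1) then -1 else 0).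

Definition symplectic (R : pzRingType) (m : nat) (S : 'M[R]_m) : Prop :=
  S *m Omega R m *m S^T = Omega R m.

Definition zsign (R : pzRingType) (a : nat) : R := if odd a then -1 else 1.

(* T_G in Sp(2K), K = N+M, coordinates: first 2N data coordinates (modes 1..N),
   then 2M ancilla coordinates (modes N+1..N+M).  On the pair
   (data mode i, ancilla mode i), i <= N, it acts as
   S_G = [[sqrt G I_2, sqrt(G-1) Z],[sqrt(G-1) Z, sqrt G I_2]], and as the
   identity on ancilla modes N+1..M.  Gains are indexed 0..N-1 (G k = G_{k+1}). *)
Definition TG (R : rcfType) (N M : nat) (G : nat -> R) : 'M[R]_(2 * N + 2 * M) :=
  block_mx
    (\matrix_(a < 2 * N, b < 2 * N)
       (if nat_of_ord a == nat_of_ord b then Num.sqrt (G a./2) else 0))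
    (\matrix_(a < 2 * N, c < 2 * M)
       (if nat_of_ord a == nat_of_ord c
        then Num.sqrt (G a./2 - 1) * zsign R a else 0))
    (\matrix_(c < 2 * M, a < 2 * N)
       (if nat_of_ord a == nat_of_ord c
        then Num.sqrt (G a./2 - 1) * zsign R a else 0))
    (\matrix_(c < 2 * M, c' < 2 * M)
       (if nat_of_ord c == nat_of_ord c'
        then (if (nat_of_ord c < 2 * N)%N then Num.sqrt (G c./2) else 1) else 0)).

(* Column vector of R^m viewed as an m-tuple (the carrier of the product
   (Borel) sigma-algebra on R^m in MathComp-Analysis). *)
Definition tuple_of_cV (R : Type) (m : nat) (v : 'cV[R]_m) : m.-tuple R :=
  mktuple (fun i => v i 0).

(* xi : T -> R^m has law N(0, s^2 I_m): its coordinates are measurable and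
   the joint law is the product of m copies of N(0, s^2), i.e. it agrees with
   the product measure on all measurable rectangles (which determines it). *)
Definition iid_gaussian (R : realType) (d : measure_display) (T : measurableType d)
  (P : probability T R) (m : nat) (s : R) (xi : T -> 'cV[R]_m) : Prop :=
  (forall i : 'I_m, measurable_fun setT (fun t => xi t i 0)) /\
  (forall A : 'I_m -> set R, (forall i, measurable (A i)) ->
     P (fun t : T => forall i : 'I_m, A i (xi t i 0)) =
     (\prod_(i < m) normal_prob 0 s (A i))%E).

(* Main.v *)
(** Subtracting from each data coordinate its linear regression on the matching
    ancilla coordinate leaves a residual w = <u, xi>, where u is orthogonal to
    every row of the ancilla part and |u|^2 = 1 / (2 G - 1).  The reflection
    along u preserves the law of xi, fixes the ancilla vector y_a and negates w,
    so E (w + h(y_a))^2 is the average of E (w + h)^2 and E (- w + h)^2, namely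
    E w^2 + E h^2 >= E w^2.  The reflection is conjugated into a coordinate flip
    by rotations in coordinate planes; these preserve the Gaussian product law
    because a planar rotation is a product of three shears, each of which
    preserves Lebesgue measure by Fubini and translation invariance. *)

Require Import Defs.
From HB Require Import structures.
From mathcomp Require Import all_boot all_order all_algebra.
From mathcomp Require Import all_classical all_reals all_analysis.
From mathcomp Require Import measurable_realfun ring lra.
Set Implicit Arguments. Unset Strict Implicit. Unset Printing Implicit Defensive.
Import Order.TTheory GRing.Theory Num.Theory.
Local Open Scope classical_set_scope.
Local Open Scope ring_scope.

(** * Translation invariance of Lebesgue measure *)

Section lebesgue_translation.
Variable R : realType.
Notation mu := (@lebesgue_measure R).
Implicit Type a : R.

Definition translation a (x : measurableTypeR R) : measurableTypeR R := x + a.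

Lemma measurable_translation a : measurable_fun setT (translation a).
Proof. by apply: measurable_funD. Qed.

(** Lebesgue measure is determined by its values on half-open intervals, whose length a shift
    preserves. *)
Lemma lebesgue_measure_translation a (A : set R) : measurable A ->
  pushforward mu (translation a) A = mu A.
Proof.
move=> mA; apply/esym.
pose Sh : {mfun _ >-> _} := HB.pack (translation a)
  (isMeasurableFun.Build _ _ _ _ _ (measurable_translation a)).
apply: (lebesgue_measure_unique (mu := pushforward mu Sh)) => //= X [[x y] /= _ <-].
rewrite /pushforward.
have -> : translation a @^-1` `]x, y] = `]x - a, y - a]%classic.
  by apply/seteqP; split => z /=; rewrite /translation !in_itv/= ltrBlDr lerBrDr.
rewrite !lebesgue_measure_itv/= !lte_fin ltrD2r -!EFinD.
by case: ifP => // _; congr EFin; ring.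
Qed.

Lemma ge0_integral_translation a (f : R -> \bar R) : measurable_fun setT f ->
  (forall x, 0 <= f x)%E ->
  (\int[mu]_x f (x + a)%R = \int[mu]_x f x)%E.
Proof.
move=> mf f0.
pose Sh : {mfun _ >-> _} := HB.pack (translation a)
  (isMeasurableFun.Build _ _ _ _ _ (measurable_translation a)).
transitivity (\int[pushforward mu Sh]_x f x)%E.
  by rewrite ge0_integral_pushforward.
by apply: eq_measure_integral => //= A mA _; exact: lebesgue_measure_translation.
Qed.

End lebesgue_translation.

(** * Integration against a normal law through its density *)

Section normal.
Variables (R : realType) (s : R).
Notation mu := (@lebesgue_measure R).

Import HBNNSimple.

(** On indicators this is the definition of [normal_prob]. Linearity extends it to simple functions,
    and monotone convergence, applied on both sides to the same approximating sequence, to [f]. *)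
Lemma ge0_integral_normal_prob (m : R) (f : R -> \bar R) : measurable_fun setT f ->
  (forall x, 0 <= f x)%E ->
  (\int[normal_prob m s]_x f x = \int[mu]_x (f x * (normal_pdf m s x)%:E))%E.
Proof.
have mpdf : measurable_fun [set: R] (EFin \o normal_pdf m s).
  by apply/measurable_EFinP; exact: measurable_normal_pdf.
have pdf0 x : (0 <= (normal_pdf m s x)%:E)%E by rewrite lee_fin normal_pdf_ge0.
move=> mf f0.
pose f_ := @nnsfun_approx _ (measurableTypeR R) R setT measurableT f mf.
transitivity (lim (\int[normal_prob m s]_x (f_ n x)%:E @[n --> \oo])%E).
  rewrite -monotone_convergence//=.
  - apply: eq_integral => ? /[!inE] xD; apply/esym/cvg_lim => //=.
    exact: cvg_nnsfun_approx.
  - by move=> n; apply/measurable_EFinP.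
  - by move=> n ? _; rewrite lee_fin.
  - by move=> ? _ ? ? mn; rewrite lee_fin; exact/lefP/nd_nnsfun_approx.
transitivity (lim (\int[mu]_x ((f_ n x)%:E * (normal_pdf m s x)%:E)
    @[n --> \oo])%E); last first.
  rewrite -monotone_convergence//=.
  - apply: eq_integral => x _; apply/cvg_lim => //=.
    by apply: cvgeZr => //; exact: (@cvg_nnsfun_approx _ (measurableTypeR R)).
  - by move=> n; apply: emeasurable_funM => //; apply/measurable_EFinP.
  - by move=> n x _; rewrite mule_ge0// lee_fin.
  - move=> x _ a b ab; apply: lee_wpmul2r => //.
    by rewrite lee_fin; exact/lefP/nd_nnsfun_approx.
(* From here on the integrand is simple; it is expanded over its level sets. *)
apply: congr_lim; apply/funext => n /=.
transitivity (\int[normal_prob m s]_x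
    (\sum_(r \in range (f_ n)) (r * \1_(f_ n @^-1` [set r]) x)%:E))%E.
  by apply: eq_integral => x _; rewrite fimfunE -fsumEFin.
transitivity (\int[mu]_x (\sum_(r \in range (f_ n))
    ((r * \1_(f_ n @^-1` [set r]) x)%:E * (normal_pdf m s x)%:E)))%E; last first.
  apply: eq_integral => x _; rewrite -ge0_mule_fsuml ?fsumEFin -?fimfunE// => r.
  by rewrite EFinM nnfun_muleindic_ge0.
have mi r : measurable (f_ n @^-1` [set r]) by exact: measurable_funPTI.
rewrite !ge0_integral_fsum//.
- apply: eq_fsbigr => r rf.
  have r0 : 0 <= r by move: rf; rewrite inE => -[x _ <-]; exact: fun_ge0.
  rewrite integralZl_indic_nnsfun//= integral_indic//= setIT.
  under [RHS]eq_integral do rewrite EFinM -muleA.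
  rewrite ge0_integralZl//; first last.
  - by move=> x _; rewrite mule_ge0// lee_fin.
  - by apply: emeasurable_funM => //; apply/measurable_EFinP; exact: measurable_indic.
  congr (_ * _)%E; rewrite /normal_prob [LHS]integral_mkcond/=.
  congr (integral _ _ _); apply/funext => x.
  by rewrite patchE indicE; case: ifP => _; rewrite ?mul1e ?mul0e.
- move=> r; apply: emeasurable_funM => //; apply/measurable_EFinP.
  by apply: measurable_funM => //; exact: measurable_indic.
- by move=> r x _; rewrite mule_ge0// EFinM nnfun_muleindic_ge0.
- move=> r; apply/measurable_EFinP.
  by apply: measurable_funM => //; exact: measurable_indic.
- by move=> r x _; rewrite EFinM nnfun_muleindic_ge0.
Qed.

End normal.

(** * Symmetry of the centred normal law under negation *)

Section normal_symmetry.
Variables (R : realType) (sigma : R).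
Notation mu := (@lebesgue_measure R).

Lemma ge0_integral_opp (f : R -> \bar R) : measurable_fun setT f ->
  (forall x, 0 <= f x)%E ->
  (\int[mu]_x f (- x)%R = \int[mu]_x f x)%E.
Proof.
move=> mf f0.
have mo : measurable_fun [set: measurableTypeR R] (-%R : _ -> measurableTypeR R).
  by [].
pose O : {mfun _ >-> _} := HB.pack (-%R : measurableTypeR R -> measurableTypeR R)
  (isMeasurableFun.Build _ _ _ _ _ mo).
transitivity (\int[pushforward mu O]_x f x)%E.
  by rewrite ge0_integral_pushforward.
by apply: eq_measure_integral => //= A mA _; exact: lebesgue_measureN.
Qed.

Lemma normal_prob_opp (A : set R) : sigma != 0 -> measurable A ->
  normal_prob 0 sigma (-%R @^-1` A) = normal_prob 0 sigma A.
Proof.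
move=> s0 mA; rewrite /normal_prob [LHS]integral_mkcond [RHS]integral_mkcond/=.
rewrite -[RHS]ge0_integral_opp; first last.
- by move=> x; rewrite patchE; case: ifP; rewrite // lee_fin normal_pdf_ge0.
- apply/(measurable_restrictT _ mA)/measurable_funTS/measurable_EFinP.
  exact: measurable_normal_pdf.
congr (integral _ _ _); apply/funext => x.
rewrite !patchE; have -> : (x \in -%R @^-1` A) = (- x \in A).
  by apply/idP/idP; rewrite !inE.
by rewrite normal_pdfE// /normal_fun !subr0 sqrrN.
Qed.

End normal_symmetry.

(** * Planar shears and rotations preserve Lebesgue measure *)

Section planar.
Variable R : realType.
Notation mu := (@lebesgue_measure R).
Notation RR := (measurableTypeR R * measurableTypeR R)%type.
Implicit Types (H : RR -> \bar R) (a b c s : R).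

Definition shearl a (z : RR) : RR := (z.1 + a * z.2, z.2).
Definition shearr b (z : RR) : RR := (z.1, z.2 + b * z.1).
Definition rotation c s (z : RR) : RR := (c * z.1 - s * z.2, s * z.1 + c * z.2).

Lemma measurable_shearl a : measurable_fun setT (shearl a).
Proof.
apply: measurable_fun_pair => //=.
by apply: measurable_funD => //; apply: measurable_funM.
Qed.

Lemma measurable_shearr a : measurable_fun setT (shearr a).
Proof.
apply: measurable_fun_pair => //=.
by apply: measurable_funD => //; apply: measurable_funM.
Qed.

Lemma measurable_rotation c s : measurable_fun setT (rotation c s).
Proof.
apply: measurable_fun_pair => /=.
- by apply: measurable_funB => //; apply: measurable_funM.
- by apply: measurable_funD => //; apply: measurable_funM.
Qed.

(** Tonelli with the first coordinate innermost: once the second coordinate is fixed, the shear is a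
    translation. *)
Lemma ge0_integral_shearl H a : measurable_fun setT H -> (forall z, 0 <= H z)%E ->
  (\int[mu \x mu]_z H (shearl a z) = \int[mu \x mu]_z H z)%E.
Proof.
move=> mH H0.
rewrite !fubini_tonelli2//; last first.
  by apply: measurableT_comp => //; exact: measurable_shearl.
apply: eq_integral => y _; rewrite /fubini_G/=.
apply: (ge0_integral_translation (a * y) (f := fun x => H (x, y))) => //.
by apply: measurableT_comp.
Qed.

Lemma ge0_integral_shearr H a : measurable_fun setT H -> (forall z, 0 <= H z)%E ->
  (\int[mu \x mu]_z H (shearr a z) = \int[mu \x mu]_z H z)%E.
Proof.
move=> mH H0.
rewrite !fubini_tonelli1//; last first.
  by apply: measurableT_comp => //; exact: measurable_shearr.
apply: eq_integral => y _; rewrite /fubini_F/=.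
apply: (ge0_integral_translation (a * y) (f := fun x => H (y, x))) => //.
by apply: measurableT_comp.
Qed.

(** For angle t the outer shear coefficient [- s / (1 + c)] is -tan(t/2), which is why the half turn
    [c = -1] is excluded. *)
Lemma rotation_shear c s z : c != -1 -> c ^+ 2 + s ^+ 2 = 1 ->
  rotation c s z = shearl (- s / (1 + c)) (shearr s (shearl (- s / (1 + c)) z)).
Proof.
move=> c1 cs1; have c10 : 1 + c != 0 by rewrite addrC addr_eq0.
set a := - s / (1 + c).
have ac : a * c = - s - a by rewrite /a; field.
have asc : a * s = c - 1.
  apply: (mulIf c10); rewrite mulrAC [a * (1 + c)]mulrDr mulr1 ac.
  have -> : (c - 1) * (1 + c) = c ^+ 2 - (c ^+ 2 + s ^+ 2) by rewrite cs1; ring.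
  by ring.
rewrite /rotation /shearl /shearr/=; congr pair.
  transitivity (z.1 * (1 + a * s) + z.2 * (a + a + a * (a * s))); last by ring.
  rewrite asc mulrBr ac; ring.
transitivity (z.2 * (1 + a * s) + s * z.1); last by ring.
by rewrite asc; ring.
Qed.

Lemma ge0_integral_rotation H c s : c != -1 -> c ^+ 2 + s ^+ 2 = 1 ->
  measurable_fun setT H -> (forall z, 0 <= H z)%E ->
  (\int[mu \x mu]_z H (rotation c s z) = \int[mu \x mu]_z H z)%E.
Proof.
move=> c1 cs1 mH H0.
under eq_integral do rewrite rotation_shear//.
set a := - s / (1 + c).
rewrite (ge0_integral_shearl (H := fun z => H (shearl a (shearr s z))))//; last first.
  apply: measurableT_comp => //.
  by apply: measurableT_comp; [exact: measurable_shearl|exact: measurable_shearr].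
rewrite (ge0_integral_shearr (H := fun z => H (shearl a z)))//; last first.
  by apply: measurableT_comp => //; exact: measurable_shearl.
exact: ge0_integral_shearl.
Qed.

End planar.

(** The invariance of integrals is applied to the indicator of a rectangle. *)
Lemma preimage_product_measure (R : realType) (d1 d2 : measure_display)
    (T1 : measurableType d1) (T2 : measurableType d2)
    (P1 : probability T1 R) (P2 : probability T2 R) (f : T1 * T2 -> T1 * T2) :
  measurable_fun setT f ->
  (forall F : T1 * T2 -> \bar R, measurable_fun setT F -> (forall z, 0 <= F z)%E ->
    \int[P1 \x P2]_z F (f z) = \int[P1 \x P2]_z F z)%E ->
  forall A B, measurable A -> measurable B ->
  (P1 \x P2)%E (f @^-1` (A `*` B)) = (P1 A * P2 B)%E.
Proof.
move=> mf fE A B mA mB.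
have mAB : measurable (A `*` B) by exact: measurableX.
have mfAB : measurable (f @^-1` (A `*` B)).
  by rewrite -[X in measurable X]setTI; apply: mf.
rewrite -product_measure1E//.
transitivity (\int[P1 \x P2]_z (\1_(A `*` B) (f z))%:E)%E.
  by rewrite (integral_indic _ measurableT mfAB) setIT.
rewrite (fE (EFin \o \1_(A `*` B)))//=; first by rewrite integral_indic// setIT.
by apply/measurable_EFinP; exact: measurable_indic.
Qed.

(** * Rotation invariance of the planar Gaussian law *)

Section planar_normal.
Variables (R : realType) (sigma : R).
Hypothesis sigma0 : sigma != 0.
Notation mu := (@lebesgue_measure R).
Notation gamma := (normal_prob 0 sigma).
Notation RR := (measurableTypeR R * measurableTypeR R)%type.
Implicit Types (F : RR -> \bar R) (c s : R).

Lemma ge0_integral_normal_prod F : measurable_fun setT F -> (forall z, 0 <= F z)%E ->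
  (\int[gamma \x gamma]_z F z =
   \int[mu \x mu]_z (F z * (normal_pdf 0 sigma z.1 * normal_pdf 0 sigma z.2)%:E))%E.
Proof.
move=> mF F0.
have mp := @measurable_normal_pdf R 0 sigma.
have p0 x : (0 <= (normal_pdf 0 sigma x)%:E :> \bar R)%E.
  by rewrite lee_fin normal_pdf_ge0.
have mpp : measurable_fun setT
    (fun z : RR => (normal_pdf 0 sigma z.1 * normal_pdf 0 sigma z.2)%:E).
  by apply/measurable_EFinP; apply: measurable_funM; exact: measurableT_comp.
rewrite fubini_tonelli1// fubini_tonelli1//; last 2 first.
- exact: emeasurable_funM.
- by move=> z; rewrite mule_ge0// EFinM mule_ge0.
rewrite ge0_integral_normal_prob//; first last.
- by move=> x; exact: integral_ge0.
- exact: measurable_fun_fubini_tonelli_F.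
apply: eq_integral => x _; rewrite /fubini_F/=.
rewrite ge0_integral_normal_prob//; last exact: measurableT_comp.
rewrite -ge0_integralZr//.
- by apply: eq_integral => y _; rewrite -muleA -EFinM mulrC.
- by apply: emeasurable_funM; [exact: measurableT_comp|exact/measurable_EFinP].
- by move=> y _; rewrite mule_ge0.
Qed.

(** The product density depends on [z] only through [z.1 ^+ 2 + z.2 ^+ 2]. *)
Lemma normal_pdf_rotation c s (z : RR) : c ^+ 2 + s ^+ 2 = 1 ->
  normal_pdf 0 sigma (rotation c s z).1 * normal_pdf 0 sigma (rotation c s z).2 =
  normal_pdf 0 sigma z.1 * normal_pdf 0 sigma z.2.
Proof.
move=> cs1; rewrite normal_pdfE// mulrACA [RHS]mulrACA; congr (_ * _).
rewrite /normal_fun -!expRD; congr expR.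
rewrite -!mulrDl !subr0 /rotation/=; congr (_ / _).
transitivity (- ((c ^+ 2 + s ^+ 2) * (z.1 ^+ 2 + z.2 ^+ 2))); first by ring.
by rewrite cs1; ring.
Qed.

Lemma ge0_integral_normal_rotation F c s : c != -1 -> c ^+ 2 + s ^+ 2 = 1 ->
  measurable_fun setT F -> (forall z, 0 <= F z)%E ->
  (\int[gamma \x gamma]_z F (rotation c s z) = \int[gamma \x gamma]_z F z)%E.
Proof.
move=> c1 cs1 mF F0.
rewrite !ge0_integral_normal_prod//; last first.
  by apply: measurableT_comp => //; exact: measurable_rotation.
under eq_integral do rewrite -(normal_pdf_rotation _ cs1).
rewrite (ge0_integral_rotation (H := fun z =>
  F z * (normal_pdf 0 sigma z.1 * normal_pdf 0 sigma z.2)%:E)%E)//.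
- apply: emeasurable_funM => //; have mp := @measurable_normal_pdf R 0 sigma.
  by apply/measurable_EFinP; apply: measurable_funM; exact: measurableT_comp.
- by move=> z; rewrite mule_ge0// lee_fin mulr_ge0// normal_pdf_ge0.
Qed.

Lemma normal_prod_rotation c s (A B : set R) : c != -1 -> c ^+ 2 + s ^+ 2 = 1 ->
  measurable A -> measurable B ->
  (gamma \x gamma)%E (rotation c s @^-1` (A `*` B)) = (gamma A * gamma B)%E.
Proof.
move=> c1 cs1 mA mB.
apply: preimage_product_measure => //; first exact: measurable_rotation.
by move=> F mF F0; exact: ge0_integral_normal_rotation.
Qed.

End planar_normal.

(** * Lower bound for the second moment of the normal law *)

Section normal_moment.
Variables (R : realType) (sigma : R).
Hypothesis sigma0 : 0 < sigma.
Notation mu := (@lebesgue_measure R).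

(* Comparing the densities of variances sigma^2 and s^2 < sigma^2 through
   exp v - exp u <= exp v * (v - u) bounds the second moment below by a
   difference quotient of the normalising constants. *)
Lemma normal_second_moment_approx s : 0 < s < sigma ->
  ((s ^+ 2)%:E <= \int[normal_prob 0 sigma]_x (x ^+ 2)%:E)%E.
Proof.
move=> /andP[s0 ssigma].
have sn0 : s != 0 by rewrite gt_eqF.
have sigman0 : sigma != 0 by rewrite gt_eqF.
(* The rate for which the Gaussian exponential of variance s^2 is that of variance sigma^2 times
   exp(- k x^2). *)
pose k := (s ^- 2 - sigma ^- 2) / 2.
have k0 : 0 < k.
  rewrite divr_gt0// subr_gt0 ltf_pV2 ?posrE ?exprn_gt0//.
  by rewrite ltr_pXn2r// nnegrE ltW.
have peakE t : 0 < t -> normal_peak t = t^-1 * normal_peak 1 :> R.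
  move=> t0; rewrite /normal_peak expr1n mul1r -mulrnAr sqrtrM ?sqr_ge0//.
  by rewrite sqrtr_sqr gtr0_norm// invfM.
have le_pdf x : normal_pdf 0 sigma x <=
    s / sigma * normal_pdf 0 s x + k * (x ^+ 2 * normal_pdf 0 sigma x).
  rewrite !normal_pdfE// (peakE _ s0) (peakE _ sigma0).
  have p0 : 0 < sigma^-1 * normal_peak 1.
    by apply: mulr_gt0; [rewrite invr_gt0|apply: normal_peak_gt0; exact: oner_neq0].
  have -> : s / sigma * (s^-1 * normal_peak 1 * normal_fun 0 s x) +
     k * (x ^+ 2 * (sigma^-1 * normal_peak 1 * normal_fun 0 sigma x)) =
     sigma^-1 * normal_peak 1 * (normal_fun 0 s x + k * x ^+ 2 * normal_fun 0 sigma x).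
    by field; rewrite sn0 sigman0.
  rewrite ler_pM2l// /normal_fun !subr0.
  set v := - x ^+ 2 / (sigma ^+ 2 *+ 2).
  have -> : - x ^+ 2 / (s ^+ 2 *+ 2) = v - k * x ^+ 2.
    by rewrite /v /k; field; rewrite sn0 sigman0.
  rewrite expRD; have := expR_ge1Dx (- (k * x ^+ 2)); have := expR_gt0 v.
  set e := expR v; set e' := expR _ => e0 e'k.
  have := ler_wpM2l (ltW e0) e'k; lra.
have mp t : measurable_fun [set: R] (EFin \o normal_pdf 0 t).
  by apply/measurable_EFinP; exact: measurable_normal_pdf.
have p0 t x : (0 <= (normal_pdf 0 t x)%:E :> \bar R)%E.
  by rewrite lee_fin normal_pdf_ge0.
have mx2 : measurable_fun [set: R] (fun x : R => (x ^+ 2)%:E).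
  by apply/measurable_EFinP; apply: measurable_funX.
have mxp : measurable_fun [set: R]
    (fun x : R => (x ^+ 2)%:E * (normal_pdf 0 sigma x)%:E)%E.
  exact: emeasurable_funM mx2 (mp sigma).
(* [le_pdf] is integrated; both densities have total mass 1. *)
have : (1 <= (s / sigma)%:E + k%:E * \int[normal_prob 0 sigma]_x (x ^+ 2)%:E)%E.
  rewrite ge0_integral_normal_prob//; last by move=> x; rewrite lee_fin sqr_ge0.
  rewrite -[X in (X <= _)%E](integral_normal_pdf 0 sigma).
  rewrite -[X in (_ <= X + _)%E]mule1 -(integral_normal_pdf 0 s).
  rewrite -ge0_integralZl//; first last.
  - by rewrite lee_fin divr_ge0// ltW.
  - exact: mp s.
  rewrite -ge0_integralZl//; first last.
  - by rewrite lee_fin ltW.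
  - by move=> x _; rewrite mule_ge0// lee_fin sqr_ge0.
  rewrite -ge0_integralD//; first last.
  - exact: measurable_funeM mxp.
  - by move=> x _; rewrite !mule_ge0// lee_fin ?sqr_ge0// ltW.
  - exact: measurable_funeM (mp s).
  - by move=> x _; rewrite mule_ge0// lee_fin divr_ge0// ltW.
  apply: ge0_le_integral => //.
  - exact: mp sigma.
  - apply: emeasurable_funD; first exact: measurable_funeM (mp s).
    exact: measurable_funeM mxp.
  - by move=> x _; rewrite -!EFinM -EFinD lee_fin.
have : (0 <= \int[normal_prob 0 sigma]_x (x ^+ 2)%:E)%E.
  by apply: integral_ge0 => x _; rewrite lee_fin sqr_ge0.
case: (\int[_]_x _)%E => [r _| _ _|//]; last exact: leey.
rewrite -EFinM -EFinD !lee_fin => rk.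
(* The bound now reads 1 - s / sigma <= k r. Both sides contain the positive factor sigma - s, and
   the next step cancels it. *)
have kE : k = (sigma - s) * (sigma + s) / (2 * s ^+ 2 * sigma ^+ 2).
  by rewrite /k; field; rewrite sn0 sigman0.
have : 2 * s ^+ 2 * sigma <= (sigma + s) * r.
  have c0 : 0 < (sigma - s) / (2 * s ^+ 2 * sigma ^+ 2).
    by rewrite divr_gt0 ?subr_gt0// !mulr_gt0// exprn_gt0.
  rewrite -(ler_pM2l c0).
  have -> : (sigma - s) / (2 * s ^+ 2 * sigma ^+ 2) * (2 * s ^+ 2 * sigma) =
      1 - s / sigma.
    by field; rewrite sn0 sigman0.
  have -> : (sigma - s) / (2 * s ^+ 2 * sigma ^+ 2) * ((sigma + s) * r) = k * r.
    by rewrite kE; field; rewrite sn0 sigman0.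
  by rewrite lerBlDl.
move=> h; have ps : 0 < sigma + s by rewrite addr_gt0.
rewrite -(ler_pM2l ps); apply: le_trans h.
have : 0 <= s ^+ 2 * (sigma - s) by rewrite mulr_ge0 ?sqr_ge0// subr_ge0 ltW.
lra.
Qed.

(** The approximate bound holds for every s below sigma, so it passes to the supremum. *)
Lemma normal_second_moment_ge :
  ((sigma ^+ 2)%:E <= \int[normal_prob 0 sigma]_x (x ^+ 2)%:E)%E.
Proof.
have := normal_second_moment_approx.
have : (0 <= \int[normal_prob 0 sigma]_x (x ^+ 2)%:E)%E.
  by apply: integral_ge0 => x _; rewrite lee_fin sqr_ge0.
case: (\int[_]_x _)%E => [r|_ _|//]; last exact: leey.
rewrite !lee_fin => r0 H; rewrite leNgt; apply/negP => rs.
have qs : Num.sqrt r < sigma.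
  by rewrite -(gtr0_norm sigma0) -sqrtr_sqr ltr_sqrt// exprn_gt0.
have q0 := sqrtr_ge0 r.
(* If the moment r were below sigma^2, the midpoint of sqrt r and sigma would be an admissible s
   with s^2 > r. *)
have : 0 < (Num.sqrt r + sigma) / 2 < sigma by apply/andP; split; lra.
move/H; rewrite lee_fin leNgt => /negP; apply.
rewrite -[X in X < _](sqr_sqrtr r0) ltr_pXn2r// ?nnegrE//; lra.
Qed.

End normal_moment.

(** * Laws determined by their values on generating families *)

Section law_uniqueness.
Local Open Scope ereal_scope.
Variables (R : realType) (d : measure_display) (T : measurableType d).
Variable P : probability T R.

Lemma ge0_integral_eq_law (d' : measure_display) (U : measurableType d')
    (m : {measure set U -> \bar R}) (X : T -> U) :
  measurable_fun setT X ->
  (forall A, measurable A -> P (X @^-1` A) = m A) ->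
  forall F : U -> \bar R, measurable_fun setT F -> (forall x, 0 <= F x) ->
  \int[P]_t F (X t) = \int[m]_x F x.
Proof.
move=> mX XE F mF F0.
pose X' : {mfun T >-> U} := HB.pack X (isMeasurableFun.Build _ _ _ _ _ mX).
transitivity (\int[pushforward P X']_x F x).
  by rewrite ge0_integral_pushforward.
by apply: eq_measure_integral => A mA _; exact: XE.
Qed.

Lemma eq_prob_preimage (d' : measure_display) (U : measurableType d')
    (G : set (set U)) (X Y : T -> U) :
  measurable = <<s G >> -> setI_closed G -> G setT ->
  measurable_fun setT X -> measurable_fun setT Y ->
  (forall A, G A -> P (X @^-1` A) = P (Y @^-1` A)) ->
  forall A, measurable A -> P (X @^-1` A) = P (Y @^-1` A).
Proof.
move=> GE GI GT mX mY XY A mA.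
pose X' : {mfun T >-> U} := HB.pack X (isMeasurableFun.Build _ _ _ _ _ mX).
pose Y' : {mfun T >-> U} := HB.pack Y (isMeasurableFun.Build _ _ _ _ _ mY).
apply: (@measure_unique _ R _ G (fun=> setT) GE GI _ _ (pushforward P X')
  (pushforward P Y')) => //.
- by rewrite bigcup_const.
- by move=> k; rewrite /= /pushforward preimage_setT probability_setT ltry.
Qed.

(** Two finite measures that agree on rectangles agree everywhere. The event [E] is there to carry
    constraints on further coordinates, with [c] as their probability. *)
Lemma prob_pair_unique (d1 d2 : measure_display) (T1 : measurableType d1)
    (T2 : measurableType d2) (P1 : probability T1 R) (P2 : probability T2 R)
    (Z : T -> T1 * T2) (E : set T) (c : \bar R) :
  measurable_fun setT Z -> measurable E -> c \is a fin_num -> 0 <= c ->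
  (forall A B, measurable A -> measurable B ->
    P (E `&` Z @^-1` (A `*` B)) = c * (P1 A * P2 B)) ->
  forall X, measurable X -> P (E `&` Z @^-1` X) = c * (P1 \x P2) X.
Proof.
move=> mZ mE cfin c0 ZE X mX.
have fc0 : (0 <= fine c)%R by exact: fine_ge0.
pose Z' : {mfun T >-> _} := HB.pack Z (isMeasurableFun.Build _ _ _ _ _ mZ).
suff : pushforward (mrestr P mE) Z' X = mscale (NngNum fc0) (P1 \x P2) X.
  by rewrite /pushforward /mrestr /mscale/= fineK// setIC.
apply: (@measure_unique _ R _
  [set A `*` B | A in measurable & B in measurable] (fun=> setT)
  (measurable_prod_measurableType _ _)) => //.
- move=> _ _ [A mA [B mB <-]] [A' mA' [B' mB' <-]].
  exists (A `&` A'); first exact: measurableI.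
  by exists (B `&` B'); [exact: measurableI|rewrite setXI].
- by move=> _; exists setT => //; exists setT => //; rewrite setXTT.
- by rewrite bigcup_const.
- move=> _ [A mA [B mB <-]]; rewrite /= /pushforward /mrestr /mscale/=.
  by rewrite setIC ZE// fineK// product_measure1E.
- move=> _; rewrite /= /pushforward /mrestr preimage_setT setTI.
  by rewrite (le_lt_trans (probability_le1 _ _))// ltry.
Qed.

End law_uniqueness.

(** * Rectangles generate the sigma-algebra on tuples *)

Section tuple_law.
Local Open Scope ereal_scope.
Variables (R : realType) (m : nat).

Definition rectangle (A : 'I_m -> set R) : set (m.-tuple R) :=
  [set x | forall i, A i (tnth x i)].

Lemma measurable_rectangle A : (forall i, measurable (A i)) ->
  measurable (rectangle A).
Proof.
move=> mA; rewrite (_ : rectangle A = \bigcap_i ((@tnth _ R ^~ i) @^-1` A i)).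
  apply: fin_bigcap_measurable => // i _.
  by rewrite -[X in measurable X]setTI; exact: measurable_tnth.
by apply/seteqP; split=> [x Ax i _|x Ax i]; [exact: Ax|exact: Ax i I].
Qed.

Lemma measurable_tuple_rectangle :
  (measurable : set (set (m.-tuple R))) =
  <<s [set rectangle A | A in [set A | forall i, measurable (A i)]] >>.
Proof.
apply/seteqP; split.
- apply: smallest_sub; first exact: smallest_sigma_algebra.
  move=> B; rewrite -bigcup_seq => -[i _ [C mC <-]]; rewrite setTI.
  (* A generator constrains a single coordinate, so it is a rectangle whose other sides are
     [setT]. *)
  apply: sub_sigma_algebra; exists (fun k => if k == i then C else setT).
    by move=> k; case: ifP.
  apply/seteqP; split=> x /=; first by move=> /(_ i); rewrite eqxx.
  by move=> Cx k; case: eqP => // ->.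
- apply: smallest_sub; first exact: sigma_algebra_measurable.
  by move=> _ [A mA <-]; exact: measurable_rectangle.
Qed.

End tuple_law.

(** * Vectors with independent centred normal coordinates *)

Section iid.
Variables (R : realType) (d : measure_display) (T : measurableType d).
Variables (P : probability T R) (sigma : R).
Hypothesis sigma0 : 0 < sigma.
Notation gamma := (normal_prob 0 sigma).

Lemma measurable_cV_rectangle m (xi : T -> 'cV[R]_m) (A : 'I_m -> set R) :
  (forall i, measurable_fun setT (fun t => xi t i 0)) ->
  (forall i, measurable (A i)) ->
  measurable [set t | forall i, A i (xi t i 0)].
Proof.
move=> mxi mA.
rewrite (_ : mkset _ = \bigcap_i ((fun t => xi t i 0) @^-1` A i)).
  apply: fin_bigcap_measurable => // i _.
  by rewrite -[X in measurable X]setTI; exact: mxi.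
by apply/seteqP; split=> [x Ax i _|x Ax i]; [exact: Ax|exact: Ax i I].
Qed.

Lemma measurable_tuple_of_cV m (xi : T -> 'cV[R]_m) :
  (forall i, measurable_fun setT (fun t => xi t i 0)) ->
  measurable_fun setT (fun t => tuple_of_cV (xi t)).
Proof.
move=> mxi; apply/measurable_fun_tnthP => i.
rewrite (_ : _ \o _ = fun t => xi t i 0)//.
by apply/funext => t; rewrite /= tnth_mktuple.
Qed.

Lemma measurable_mulmx m n (V : 'M[R]_(n, m)) (xi : T -> 'cV[R]_m) :
  (forall i, measurable_fun setT (fun t => xi t i 0)) ->
  forall i, measurable_fun setT (fun t => (V *m xi t) i 0).
Proof.
move=> mxi i.
rewrite (_ : (fun t => _) = fun t => \sum_k V i k * xi t k 0); last first.
  by apply/funext => t; rewrite mxE.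
by apply: measurable_sum => k; apply: measurable_funM.
Qed.

(** [iid_gaussian] prescribes the probability of every rectangle, and rectangles form a generating
    family closed under intersection; hence the two laws coincide. *)
Lemma iid_gaussian_ge0_integral_eq m (xi eta : T -> 'cV[R]_m)
    (F : m.-tuple R -> \bar R) :
  iid_gaussian P sigma xi -> iid_gaussian P sigma eta ->
  measurable_fun setT F -> (forall x, 0 <= F x)%E ->
  (\int[P]_t F (tuple_of_cV (xi t)) = \int[P]_t F (tuple_of_cV (eta t)))%E.
Proof.
move=> [mxi xiE] [meta etaE] mF F0.
have mX := measurable_tuple_of_cV mxi; have mY := measurable_tuple_of_cV meta.
pose Y : {mfun T >-> (m.-tuple R)} := HB.pack (fun t => tuple_of_cV (eta t))
  (isMeasurableFun.Build _ _ _ _ _ mY).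
rewrite (@ge0_integral_eq_law _ _ _ P _ _ (pushforward P Y) _ mX)//.
  by rewrite ge0_integral_pushforward.
apply: (eq_prob_preimage (@measurable_tuple_rectangle R m)) => //.
- move=> _ _ [A mA <-] [B mB <-]; exists (fun i => A i `&` B i).
    by move=> i; exact: measurableI.
  by apply/seteqP; split=> [x AB|x [Ax Bx] i]; [split=> i; have [] := AB i|split].
- by exists (fun=> setT) => //; apply/seteqP; split.
move=> _ [A mA <-].
have E (z : T -> 'cV[R]_m) : (fun t => tuple_of_cV (z t)) @^-1` rectangle A =
    (fun t => forall i, A i (z t i 0)).
  apply/funext => t; apply/propext; split=> h i; have := h i;
  by rewrite tnth_mktuple.
by rewrite !E xiE// etaE.
Qed.

Lemma iid_gaussian_marginal m (xi : T -> 'cV[R]_m) (i : 'I_m) (F : R -> \bar R) :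
  iid_gaussian P sigma xi -> measurable_fun setT F -> (forall x, 0 <= F x)%E ->
  (\int[P]_t F (xi t i 0)%R = \int[gamma]_x F x)%E.
Proof.
move=> [mxi xiE] mF F0.
apply: (@ge0_integral_eq_law _ _ _ P _ (measurableTypeR R) gamma
  (fun t => xi t i 0)) => //; first exact: mxi.
move=> A mA.
have := xiE (fun k => if k == i then A else setT).
rewrite (bigD1 i)//= eqxx big1 ?mule1 => [<-|k /negPf->].
- congr (P _); apply/seteqP; split=> [t At k|t /(_ i)]; last by rewrite eqxx.
  by case: eqP => // ->.
- by move=> k; case: ifP.
- exact: (@probability_setT _ _ _ gamma).
Qed.

(** * Rotations in coordinate planes preserve the law *)

Section rotation.
Variables (m : nat) (i j : 'I_m) (c s : R).
Hypothesis ij : i != j.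

(** A Givens rotation, acting as [rotation c s] on the coordinates [i] and [j]. *)
Definition plane_rotation : 'M[R]_m := \matrix_(k, l)
  (if k == i then c *+ (l == i) - s *+ (l == j)
   else if k == j then s *+ (l == i) + c *+ (l == j) else (k == l)%:R).

Lemma mul_plane_rotation n (V : 'M[R]_(m, n)) k l :
  (plane_rotation *m V) k l =
  if k == i then c * V i l - s * V j l
  else if k == j then s * V i l + c * V j l else V k l.
Proof.
have sumE (x : R) p : \sum_q (x *+ (q == p)) * V q l = x * V p l.
  rewrite (bigD1 p)//= eqxx mulr1n big1 ?addr0// => q /negPf->.
  by rewrite mulr0n mul0r.
rewrite mxE; under eq_bigr do rewrite mxE.
case: ifP => _; last case: ifP => _.
- by under eq_bigr do rewrite mulrBl; rewrite sumrB !sumE.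
- by under eq_bigr do rewrite mulrDl; rewrite big_split/= !sumE.
- by under eq_bigr do rewrite eq_sym; rewrite sumE mul1r.
Qed.

(** The pair of coordinates [i], [j] is independent of the others and its planar law is rotation
    invariant. *)
Lemma iid_gaussian_plane_rotation (xi : T -> 'cV[R]_m) :
  c != -1 -> c ^+ 2 + s ^+ 2 = 1 ->
  iid_gaussian P sigma xi ->
  iid_gaussian P sigma (fun t => plane_rotation *m xi t).
Proof.
move=> c1 cs1 [mxi xiE]; split=> [|A mA]; first exact: measurable_mulmx.
pose Z t : measurableTypeR R * measurableTypeR R := (xi t i 0, xi t j 0).
have mZ : measurable_fun setT Z by exact: (measurable_fun_pair (mxi i) (mxi j)).
pose A' B C k := if k == i then B else if k == j then C else A k.
have mA' B C k : measurable B -> measurable C -> measurable (A' B C k).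
  by move=> mB mC; rewrite /A'; case: ifP => // _; case: ifP.
(* [E] keeps the constraints on the coordinates other than [i] and [j]; [p] below is its
   probability. *)
pose E := [set t | forall k, A' setT setT k (xi t k 0)].
have mE : measurable E by apply: measurable_cV_rectangle => // k; exact: mA'.
pose p : \bar R := (\prod_(k < m | (k != i) && (k != j)) gamma (A k))%E.
have pfin : p \is a fin_num.
  by apply: prode_fin_num => k _; exact: (@fin_num_measure _ _ _ gamma _ (mA k)).
have p0 : (0 <= p)%E by apply: prode_ge0.
have prodE (B C : set R) (D : 'I_m -> set R) : D i = B -> D j = C ->
    (forall k, k != i -> k != j -> D k = A k) ->
    (\prod_(k < m) gamma (D k) = p * (gamma B * gamma C))%E.
  move=> DB DC DA; rewrite (bigD1 i)//= (bigD1 j) 1?eq_sym//= DB DC muleA muleC.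
  by congr (_ * _)%E; apply: eq_bigr => k /andP[ki kj]; rewrite DA.
have ZE B C : measurable B -> measurable C ->
    P (E `&` Z @^-1` (B `*` C)) = (p * (gamma B * gamma C))%E.
  move=> mB mC.
  rewrite -(@prodE B C (A' B C)) ?/A' ?eqxx//; first last.
  - by move=> k /negPf-> /negPf->.
  - by rewrite eq_sym (negPf ij).
  rewrite -xiE; last by move=> k; exact: mA'.
  congr (P _); apply/seteqP; split=> t /=.
  - move=> [Et [/= Bt Ct]] k; have := Et k; rewrite /A'.
    by case: eqP => [->//|_]; case: eqP => [->//|_].
  - move=> ABC; split.
      move=> k; have := ABC k; rewrite /A'.
      by case: eqP => // _; case: eqP.
    have := ABC i; have := ABC j.
    by rewrite /A' !eqxx eq_sym (negPf ij).
(* The rectangle [A i] times [A j] is exchanged for its preimage under the rotation. That preimage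
   need not be a rectangle, so [ZE] has to be extended to all measurable sets of the plane. *)
rewrite (prodE (A i) (A j))//.
rewrite -(normal_prod_rotation (lt0r_neq0 sigma0) c1 cs1)//.
rewrite -(prob_pair_unique mZ mE pfin p0 ZE); last first.
  rewrite -[X in measurable X]setTI; apply: measurable_rotation => //.
  exact: (measurableX (mA i) (mA j)).
congr (P _); apply/seteqP; split=> t /=.
- move=> At; split.
    move=> k; have := At k; rewrite mul_plane_rotation /A'.
    by case: eqP => // _; case: eqP.
  have := At i; have := At j.
  by rewrite !mul_plane_rotation !eqxx eq_sym (negPf ij).
- move=> [Et [/= Bt Ct]] k; have := Et k; rewrite mul_plane_rotation /A'.
  by case: eqP => [->//|_]; case: eqP => [->//|_].
Qed.

End rotation.

Lemma mul_plane_rotationV m (i j : 'I_m) (c s : R) : i != j -> c ^+ 2 + s ^+ 2 = 1 ->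
  plane_rotation i j c (- s) *m plane_rotation i j c s = 1%:M.
Proof.
move=> ij cs1; apply/matrixP => k l.
rewrite mul_plane_rotation // !mxE !eqxx [j == i]eq_sym (negPf ij).
case: (eqVneq k i) => [->|ki].
  rewrite [i == l]eq_sym; have [->|li] := eqVneq l i.
    rewrite (negPf ij) !mulr1n !mulr0n subr0 addr0 mulNr opprK -!expr2.
    by rewrite cs1.
  by rewrite !mulr0n; ring.
case: (eqVneq k j) => [->|kj]; last by [].
rewrite [j == l]eq_sym; have [->|lj] := eqVneq l j.
  rewrite eq_sym (negPf ij) !mulr1n !mulr0n sub0r add0r mulrN mulNr opprK -!expr2.
  by rewrite addrC cs1.
by rewrite !mulr0n; ring.
Qed.

Lemma tr_plane_rotation m (i j : 'I_m) (c s : R) : i != j ->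
  (plane_rotation i j c s)^T = plane_rotation i j c (- s).
Proof.
move=> ij; apply/matrixP => k l; rewrite !mxE.
have [li|li] := eqVneq l i.
  have [ki|ki] := eqVneq k i; first by rewrite ki li (negPf ij) !mulr0n oppr0.
  have [kj|kj] := eqVneq k j; first by rewrite li (negPf ij) !(mulr0n, mulr1n); ring.
  by rewrite li (negPf ki) !mulr0n subr0.
have [lj|lj] := eqVneq l j.
  have [ki|ki] := eqVneq k i; first by rewrite ki (negPf ij) !(mulr0n, mulr1n); ring.
  have [kj|kj] := eqVneq k j; first by rewrite !(mulr0n, mulr1n); ring.
  by rewrite lj (negPf kj) !mulr0n addr0.
have [ki|ki] := eqVneq k i; first by rewrite ki (negPf li) !mulr0n; ring.
have [kj|kj] := eqVneq k j; first by rewrite kj (negPf lj) !mulr0n; ring.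
by rewrite eq_sym.
Qed.

End iid.

(** * Householder reflections *)

Section householder.
Variables (R : realFieldType) (m : nat).
Implicit Types (u v : 'cV[R]_m) (V : 'M[R]_m).

Definition dot u v : R := (u^T *m v) 0 0.

(* For u = 0 the junk value 2 / 0 = 0 is harmless: householder 0 = 1. *)
Definition householder u : 'M[R]_m := 1%:M - (2 / dot u u) *: (u *m u^T).

Lemma dotE u v : dot u v = \sum_k u k 0 * v k 0.
Proof. by rewrite /dot mxE; apply: eq_bigr => k _; rewrite mxE. Qed.

Lemma dot_orthogonal V u v : V^T *m V = 1%:M -> dot (V *m u) (V *m v) = dot u v.
Proof. by move=> VV; rewrite /dot trmx_mul mulmxA -(mulmxA _ _ V) VV mulmx1. Qed.

(** Reduces the reflection along [u] to the one along a rotated vector with fewer nonzero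
    entries. *)
Lemma householder_orthogonal V u : V^T *m V = 1%:M ->
  V^T *m householder (V *m u) *m V = householder u.
Proof.
move=> VV; rewrite /householder dot_orthogonal// mulmxBr mulmxBl mulmx1 VV.
rewrite -scalemxAr -scalemxAl trmx_mul !mulmxA VV mul1mx.
by rewrite -(mulmxA _ V^T V) VV mulmx1.
Qed.

Lemma mul_householder u v : householder u *m v = v - (2 * dot u v / dot u u) *: u.
Proof.
rewrite /householder mulmxBl mul1mx -scalemxAl -mulmxA [u^T *m v]mx11_scalar.
by rewrite mul_mx_scalar scalerA -/(dot u v) mulrAC.
Qed.

Lemma dot_gt0 u : u != 0 -> 0 < dot u u.
Proof.
move=> u0; rewrite lt_neqAle dotE; apply/andP; split; last first.
  by apply: sumr_ge0 => k _; rewrite -expr2 sqr_ge0.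
apply: contra u0; rewrite eq_sym psumr_eq0 => [/allP u0|k _]; last first.
  by rewrite -expr2 sqr_ge0.
apply/eqP/colP => k; rewrite mxE; apply/eqP.
by have := u0 k; rewrite mem_index_enum mulf_eq0 orbb; apply.
Qed.

Lemma dot_householder u v : dot u (householder u *m v) = - dot u v.
Proof.
have [->|u0] := eqVneq u 0; first by rewrite /dot trmx0 !mul0mx mxE oppr0.
have d0 := lt0r_neq0 (dot_gt0 u0).
rewrite mul_householder {1}/dot mulmxBr -scalemxAr mxE -/(dot u v).
by rewrite mxE mxE -/(dot u u); field.
Qed.

Lemma dot_concentrated u v i : (forall k, k != i -> u k 0 = 0) ->
  dot u v = u i 0 * v i 0.
Proof.
move=> ui; rewrite dotE (bigD1 i)//= big1 ?addr0// => k ki.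
by rewrite ui// mul0r.
Qed.

End householder.

(** * Reflections of Gaussian vectors and the prediction error *)

Section gaussian_reflection.
Variables (R : realType) (d : measure_display) (T : measurableType d).
Variables (P : probability T R) (sigma : R) (m : nat).
Hypothesis sigma0 : 0 < sigma.
Implicit Types (xi : T -> 'cV[R]_m) (u : 'cV[R]_m).

(* Both properties of u are transported by plane rotations, which makes the
   induction on the support of u possible. *)
Definition gaussian_direction u := forall xi, iid_gaussian P sigma xi ->
  iid_gaussian P sigma (fun t => householder u *m xi t) /\
  ((sigma ^+ 2 * dot u u)%:E <= \int[P]_t (dot u (xi t) ^+ 2)%:E)%E.

Lemma iid_gaussian_flip xi (eta : T -> 'cV[R]_m) i :
  (forall t k, eta t k 0 = if k == i then - xi t k 0 else xi t k 0) ->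
  iid_gaussian P sigma xi -> iid_gaussian P sigma eta.
Proof.
move=> etaE [mxi xiE]; split=> [k|A mA].
  under eq_fun do rewrite etaE.
  case: (k == i); last exact: mxi.
  exact: (measurableT_comp (@oppr_measurable _ setT) (mxi k)).
have mNA k : measurable (-%R @^-1` A k).
  by rewrite -[X in measurable X]setTI; apply: oppr_measurable.
transitivity (P (fun t =>
    forall k, (if k == i then -%R @^-1` A k else A k) (xi t k 0))).
  congr (P _); apply/funext => t; apply/propext; split=> h k; have := h k;
  by rewrite etaE; case: ifP.
rewrite (xiE (fun k => if k == i then _ else _)); last by move=> k; case: ifP.
apply: eq_bigr => k _; case: ifP => // _.
by rewrite normal_prob_opp// lt0r_neq0.
Qed.

(** Base case: the reflection is the identity when [u] is 0 and the sign flip of coordinate [i]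
    otherwise, and the moment bound is the one-dimensional one scaled by [u i 0 ^+ 2]. *)
Lemma gaussian_direction_concentrated u i :
  (forall k, k != i -> u k 0 = 0) -> gaussian_direction u.
Proof.
move=> ui xi iid; split.
  have [ui0|ui0] := eqVneq (u i 0) 0.
    rewrite (_ : (fun t => _) = xi)//; apply/funext => t; rewrite mul_householder.
    rewrite [in X in X *: _](dot_concentrated _ ui) ui0 mul0r mulr0 mul0r.
    by rewrite scale0r subr0.
  apply: (iid_gaussian_flip (i := i) _ iid) => t k.
  rewrite mul_householder !(dot_concentrated _ ui) !mxE.
  case: eqVneq => [->|ki]; first by field.
  by rewrite (ui k ki) mulr0 subr0.
rewrite (dot_concentrated _ ui).
under eq_integral do rewrite (dot_concentrated _ ui) exprMn EFinM.
have mx2 : measurable_fun setT (fun x : R => (x ^+ 2)%:E).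
  by apply/measurable_EFinP; apply: measurable_funX.
rewrite ge0_integralZl//; first last.
- by rewrite lee_fin sqr_ge0.
- by move=> t _; rewrite lee_fin sqr_ge0.
- exact: measurableT_comp mx2 (iid.1 i).
rewrite (@iid_gaussian_marginal _ _ _ P sigma _ xi i (fun x => (x ^+ 2)%:E))//;
  last first.
  by move=> x; rewrite lee_fin sqr_ge0.
rewrite mulrC EFinM -expr2; apply: lee_wpmul2l; first by rewrite lee_fin sqr_ge0.
exact: normal_second_moment_ge.
Qed.

Lemma gaussian_direction_rotation u (i j : 'I_m) c s : i != j -> c != -1 ->
  c ^+ 2 + s ^+ 2 = 1 ->
  gaussian_direction (plane_rotation i j c s *m u) -> gaussian_direction u.
Proof.
move=> ij c1 cs1; set V := plane_rotation i j c s => Vu xi iid.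
have VV : V^T *m V = 1%:M by rewrite tr_plane_rotation// mul_plane_rotationV.
have iidV : iid_gaussian P sigma (fun t => V *m xi t).
  exact: iid_gaussian_plane_rotation.
have [iidH le_int] := Vu _ iidV; split.
  (* The reflection along [u] becomes a composite of three law-preserving maps; [V^T] is again a
     plane rotation, with the same [c] and with [- s]. *)
  rewrite -(householder_orthogonal u VV).
  rewrite (_ : (fun t => _) = fun t => V^T *m (householder (V *m u) *m (V *m xi t))).
    rewrite tr_plane_rotation//; apply: iid_gaussian_plane_rotation => //.
    by rewrite sqrrN.
  by apply/funext => t; rewrite !mulmxA.
move: le_int; rewrite dot_orthogonal//.
by under eq_integral do rewrite dot_orthogonal//.
Qed.

(** Induction on the number of nonzero entries: while two remain, a Givens rotation annihilates one
    of them. *)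
Lemma gaussian_directionT u : gaussian_direction u.
Proof.
have [n] := ubnP #|[set k | u k 0 != 0]%SET|.
elim: n u => // n IHn u; rewrite ltnS => un.
have [i ui|u0] := pickP (fun k => u k 0 != 0); last first.
  have -> : u = 0 by apply/colP => k; rewrite mxE; apply/eqP; have := u0 k; case: eqP.
  move=> xi iid; split.
    rewrite (_ : (fun t => _) = xi)//; apply/funext => t.
    by rewrite mul_householder scaler0 subr0.
  rewrite /dot trmx0 mul0mx mxE mulr0; apply: integral_ge0 => t _.
  by rewrite lee_fin sqr_ge0.
have [j /andP[ji uj]|uj] := pickP (fun k => (k != i) && (u k 0 != 0)); last first.
  apply: (gaussian_direction_concentrated (i := i)) => k ki; apply/eqP.
  by have := uj k; rewrite ki/=; case: eqP.
pose r := Num.sqrt (u i 0 ^+ 2 + u j 0 ^+ 2).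
have r2 : r ^+ 2 = u i 0 ^+ 2 + u j 0 ^+ 2 by rewrite sqr_sqrtr// addr_ge0 ?sqr_ge0.
have r0 : r != 0.
  rewrite -sqrf_eq0 r2 paddr_eq0 ?sqr_ge0// !sqrf_eq0.
  by rewrite (negPf ui).
(* This rotation sends the entries (u_i, u_j) to (r, 0). *)
pose c := u i 0 / r; pose s := - (u j 0 / r).
have cs1 : c ^+ 2 + s ^+ 2 = 1.
  by rewrite /c /s sqrrN !exprMn -mulrDl -r2 exprVn divff// sqrf_eq0.
have s0 : s != 0 by rewrite oppr_eq0 mulf_neq0// invr_eq0.
(* The half turn would force s = 0, whereas u_j is nonzero. *)
have c1 : c != -1.
  apply: contra s0 => /eqP c1; move: cs1; rewrite c1 sqrrN expr1n => /eqP.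
  by rewrite -[X in _ == X]addr0 (inj_eq (addrI 1)) sqrf_eq0.
have ij : i != j by rewrite eq_sym.
apply: (gaussian_direction_rotation ij c1 cs1); apply: IHn; apply: leq_trans un.
(* Only the entries [i] and [j] change, and both were nonzero; so the support gains nothing and
   loses [j]. *)
apply: proper_card; apply/properP; split.
  apply/fintype.subsetP => k; rewrite !inE mul_plane_rotation.
  by case: (eqVneq k i) => [->//|_]; case: (eqVneq k j) => [->//|].
exists j; rewrite !inE// mul_plane_rotation eqxx (negPf ji) negbK /c /s.
by apply/eqP; field.
Qed.

(* Averaging over the reflection, which fixes B xi and negates the coordinate
   along u, cancels the cross term. *)
Lemma gaussian_prediction_error u p (B : 'M[R]_(p, m)) (h : p.-tuple R -> R) xi :
  iid_gaussian P sigma xi -> B *m u = 0 -> measurable_fun setT h ->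
  ((sigma ^+ 2 * dot u u)%:E <=
   \int[P]_t ((dot u (xi t) + h (tuple_of_cV (B *m xi t))) ^+ 2)%:E)%E.
Proof.
move=> iid Bu mh; have [iidH le_int] := gaussian_directionT u iid.
have mxi := iid.1.

(* Equality of laws is available for functions of tuples, so the integrand is rewritten as a
   function [F] of a tuple. *)
pose cV (x : m.-tuple R) : 'cV[R]_m := \col_k tnth x k.
have cVK v : cV (tuple_of_cV v) = v.
  by apply/colP => k; rewrite mxE tnth_mktuple.
have mcV i : measurable_fun setT (fun x => cV x i 0).
  by under eq_fun do rewrite mxE; exact: measurable_tnth.
have mw : measurable_fun setT (fun t => dot u (xi t)).
  exact: (measurable_mulmx u^T mxi 0).
have mhB (d' : measure_display) (U : measurableType d') (z : U -> 'cV[R]_m) :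
    (forall i, measurable_fun setT (fun t => z t i 0)) ->
    measurable_fun setT (fun t => h (tuple_of_cV (B *m z t))).
  move=> mz; apply: measurableT_comp => //.
  by apply: measurable_tuple_of_cV; exact: measurable_mulmx.
pose F x : \bar R := ((dot u (cV x) + h (tuple_of_cV (B *m cV x))) ^+ 2)%:E.
have mF : measurable_fun setT F.
  apply/measurable_EFinP; apply: measurable_funX; apply: measurable_funD.
    exact: (measurable_mulmx u^T mcV 0).
  exact: mhB.
have F0 x : (0 <= F x)%E by rewrite lee_fin sqr_ge0.
(* [IE] will say that negating [dot u (xi t)] alone leaves the integral unchanged: the argument of
   [h] stays fixed since [B *m u = 0]. *)
have := iid_gaussian_ge0_integral_eq iid iidH mF F0.
under eq_integral do rewrite /F cVK.
under [in RHS]eq_integral do rewrite /F cVK dot_householder mul_householder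
  mulmxBr -scalemxAr Bu scaler0 subr0.
set I := (\int[P]_t _)%E => IE.
have I0 : (0 <= I)%E by apply: integral_ge0 => t _; rewrite lee_fin sqr_ge0.
(* The average is taken in doubled form, by (w + g)^2 + (- w + g)^2 = 2 w^2 + 2 g^2, which keeps
   every integrand nonnegative. *)
have : ((sigma ^+ 2 * dot u u)%:E + (sigma ^+ 2 * dot u u)%:E <= I + I)%E.
  apply: (le_trans (leeD le_int le_int)); rewrite [X in (_ <= _ + X)%E]IE /I.
  have mw2 : measurable_fun setT (fun t => (dot u (xi t) ^+ 2)%:E).
    by apply/measurable_EFinP; apply: measurable_funX.
  have mp : measurable_fun setT
      (fun t => ((dot u (xi t) + h (tuple_of_cV (B *m xi t))) ^+ 2)%:E).
    apply/measurable_EFinP; apply: measurable_funX; apply: measurable_funD => //.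
    exact: mhB.
  have mn : measurable_fun setT
      (fun t => ((- dot u (xi t) + h (tuple_of_cV (B *m xi t))) ^+ 2)%:E).
    apply/measurable_EFinP; apply: measurable_funX; apply: measurable_funD.
      exact: (measurableT_comp (@oppr_measurable _ setT) mw).
    exact: mhB.
  rewrite -!ge0_integralD//; try by move=> t _; rewrite lee_fin sqr_ge0.
  apply: ge0_le_integral => //.
  - by move=> t _; rewrite -EFinD lee_fin addr_ge0 ?sqr_ge0.
  - exact: emeasurable_funD.
  - exact: emeasurable_funD.
  - move=> t _; rewrite -!EFinD lee_fin.
    set w := dot _ _; set g := h _.
    have -> : (w + g) ^+ 2 + (- w + g) ^+ 2 = w ^+ 2 + w ^+ 2 + (g ^+ 2 + g ^+ 2).
      by ring.
    by rewrite lerDl addr_ge0 ?sqr_ge0.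
case: I {IE} I0 => [r _|_ _|//]; last exact: leey.
by rewrite -!EFinD !lee_fin; lra.
Qed.

End gaussian_reflection.

(** * Covariance blocks of two-mode squeezing *)

Lemma half_ltn_mul2 k n : (k < 2 * n)%N -> (k./2 < n)%N.
Proof.
move=> kn; rewrite -(ltn_pmul2l (isT : (0 < 2)%N)) mul2n.
by apply: leq_ltn_trans kn; rewrite -[leqRHS]odd_double_half leq_addl.
Qed.

Section two_mode_squeezing.

(** All four blocks of [TG] have this shape. Indexing the diagonal by [nat] lets one product formula
    serve blocks of different sizes. *)
Definition rect_diag (R : pzRingType) (p q : nat) (f : nat -> R) : 'M[R]_(p, q) :=
  \matrix_(a, b) (if nat_of_ord a == b then f a else 0).

Lemma mul_rect_diag_tr (R : pzRingType) (p q r : nat) (f g : nat -> R) :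
  rect_diag p q f *m (rect_diag r q g)^T =
  rect_diag p r (fun k => if (k < q)%N then f k * g k else 0).
Proof.
apply/matrixP => a b; rewrite !mxE; under eq_bigr do rewrite !mxE.
case: (ltnP a q) => aq; last first.
  rewrite big1 => [|k _]; first by case: ifP.
  by rewrite gtn_eqF ?mul0r// (leq_trans (ltn_ord k)).
rewrite (bigD1 (Ordinal aq))//= eqxx big1 ?addr0 => [|k ka]; last first.
  by rewrite eq_sym (_ : (k == a :> nat) = false) ?mul0r//; apply: contraNF ka.
by rewrite eq_sym; case: eqP => [->//|_]; rewrite mulr0.
Qed.

Variables (R : rcfType) (N M : nat) (G : nat -> R).
Hypothesis NM : (N <= M)%N.
Hypothesis G1 : forall i, (i < N)%N -> 1 <= G i.

Let NM2 : (2 * N <= 2 * M)%N. Proof. by rewrite leq_mul2l. Qed.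
Let gain (k : nat) : R := G k./2.
Let diag_dd k := Num.sqrt (gain k).
Let diag_da k := Num.sqrt (gain k - 1) * zsign R k.
Let diag_aa k := if (k < 2 * N)%N then Num.sqrt (gain k) else 1.

(** The covariance of data and ancilla coordinate [k], for unit noise. With G = cosh^2 r it is sinh
    2r up to the sign from Z, while the variance 2 G - 1 is cosh 2r. *)
Definition squeezing (k : nat) : R := 2 * Num.sqrt (gain k) * diag_da k.

Let TGE : TG N M G = block_mx
  (rect_diag (2 * N) (2 * N) diag_dd) (rect_diag (2 * N) (2 * M) diag_da)
  (rect_diag (2 * M) (2 * N) diag_da) (rect_diag (2 * M) (2 * M) diag_aa).
Proof.
congr block_mx; apply/matrixP => a b; rewrite !mxE// eq_sym.
by case: eqP => // ->.
Qed.

Let TGTE := (TGE, tr_block_mx, mulmx_block, mul_rect_diag_tr).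

Let gain_ge1 k : (k < 2 * N)%N -> 1 <= gain k.
Proof. by move=> kN; apply: G1; exact: half_ltn_mul2. Qed.

Let diag_da_sqr k : (k < 2 * N)%N -> diag_da k * diag_da k = gain k - 1.
Proof.
move=> kN; rewrite /diag_da mulrACA -expr2 sqr_sqrtr ?subr_ge0 ?gain_ge1//.
by rewrite /zsign; case: odd; rewrite ?mulrNN !mulr1.
Qed.

Let diag_dd_sqr k : (k < 2 * N)%N -> diag_dd k * diag_dd k = gain k.
Proof.
by move=> kN; rewrite -expr2 sqr_sqrtr// (le_trans ler01)// gain_ge1.
Qed.

Lemma squeezing_sqr k : (k < 2 * N)%N -> squeezing k ^+ 2 = (2 * G k./2 - 1) ^+ 2 - 1.
Proof.
move=> kN; transitivity (4 * (diag_dd k * diag_dd k) * (diag_da k * diag_da k)).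
  by rewrite /squeezing /diag_dd; ring.
by rewrite diag_dd_sqr// diag_da_sqr// -/(gain k); ring.
Qed.

Lemma ulsubmx_TGT (a : 'I_(2 * N)) :
  ulsubmx (TG N M G *m (TG N M G)^T) a a = 2 * G a./2 - 1.
Proof.
rewrite !TGTE block_mxKul !mxE eqxx ltn_ord (leq_trans (ltn_ord a))//.
by rewrite diag_dd_sqr// diag_da_sqr// -/(gain a); ring.
Qed.

Lemma dlsubmx_TGT (c : 'I_(2 * M)) (a : 'I_(2 * N)) :
  dlsubmx (TG N M G *m (TG N M G)^T) c a =
  if c == a :> nat then squeezing a else 0.
Proof.
rewrite !TGTE block_mxKdl !mxE; case: eqP => [->|_]; last by rewrite addr0.
rewrite !ltn_ord (leq_trans (ltn_ord a))// /diag_aa ltn_ord /squeezing /diag_dd.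
by ring.
Qed.

(** Restricted to columns paired with a data coordinate, the ones that serve as regressors. *)
Lemma drsubmx_TGT (c c' : 'I_(2 * M)) : (c' < 2 * N)%N ->
  drsubmx (TG N M G *m (TG N M G)^T) c c' =
  if c == c' :> nat then 2 * G c'./2 - 1 else 0.
Proof.
move=> cN; rewrite !TGTE block_mxKdr !mxE; case: eqP => [->|_]; last by rewrite addr0.
rewrite cN (leq_trans cN)// /diag_aa cN diag_da_sqr// -/(diag_dd c').
by rewrite diag_dd_sqr// -/(gain c'); ring.
Qed.

End two_mode_squeezing.

(** * Lower bound for the decoding error *)

Lemma sum_double_half (R : nmodType) (n : nat) (g : nat -> R) :
  \sum_(i < n) g i *+ 2 = \sum_(j < 2 * n) g j./2.
Proof.
elim: n => [|n IHn]; first by rewrite !big_ord0.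
rewrite big_ord_recr IHn mulnS add2n !big_ord_recr/= mul2n uphalf_double doubleK.
by rewrite mulr2n addrA.
Qed.

Section decoding.
Variables (R : realType) (d : measure_display) (T : measurableType d).
Variables (P : probability T R) (sigma : R) (N M : nat) (G : nat -> R).
Variables (W : 'M[R]_(2 * N + 2 * M)) (xi : T -> 'cV[R]_(2 * N + 2 * M)).
Hypothesis sigma0 : 0 < sigma.
Hypothesis NM : (N <= M)%N.
Hypothesis G1 : forall i, (i < N)%N -> 1 <= G i.
Hypothesis WW : W *m W^T = TG N M G *m (TG N M G)^T.
Hypothesis iid : iid_gaussian P sigma xi.

(** The data coordinate is a residual [dot u (xi t)] plus a multiple of an ancilla coordinate. That
    multiple and [h] both depend on the ancilla vector alone, so [gaussian_prediction_error] applies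
    to their difference. *)
Lemma coordinate_decoding_error (j : 'I_(2 * N)) (h : (2 * M).-tuple R -> R) :
  measurable_fun setT h ->
  ((sigma ^+ 2 / (2 * G j./2 - 1))%:E <=
   \int[P]_t ((usubmx (W *m xi t) j 0 -
     h (tuple_of_cV (dsubmx (W *m xi t)))) ^+ 2)%:E)%E.
Proof.
move=> mh.
have jM : (j < 2 * M)%N by rewrite (leq_trans (ltn_ord j))// leq_mul2l.
pose j' := Ordinal jM.
have Gj : 1 <= G j./2.
  by apply: G1; exact: half_ltn_mul2.
pose c := 2 * G j./2 - 1; have c0 : c != 0 by rewrite lt0r_neq0// /c; lra.
(* k * y_a,j is the conditional expectation of y_d,j given y_a. *)
pose k := squeezing G j / c.
pose Wd := usubmx W; pose Wa := dsubmx W.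
have WE : W = col_mx Wd Wa by rewrite vsubmxK.
pose u := (row j Wd - k *: row j' Wa)^T.
have WWE : W *m W^T = block_mx (Wd *m Wd^T) (Wd *m Wa^T) (Wa *m Wd^T) (Wa *m Wa^T).
  by rewrite {1 2}WE tr_col_mx mul_col_row.
have ddE : (Wd *m Wd^T) j j = c.
  by rewrite /c -(ulsubmx_TGT NM G1) -WW WWE block_mxKul.
have adE i : (Wa *m Wd^T) i j = if i == j :> nat then squeezing G j else 0.
  by have := dlsubmx_TGT G NM i j; rewrite -WW WWE block_mxKdl.
have aaE i : (Wa *m Wa^T) i j' = if i == j :> nat then c else 0.
  have := drsubmx_TGT NM G1 i (ltn_ord j : (j' < 2 * N)%N).
  by rewrite -WW WWE block_mxKdr.
have mulu n (V : 'M[R]_(n, _)) i :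
    (V *m u) i 0 = (V *m Wd^T) i j - k * (V *m Wa^T) i j'.
  rewrite /u linearB/= linearZ/= mulmxBr -scalemxAr !tr_row.
  by rewrite !mxE; congr (_ - _ * _); apply: eq_bigr => l _; rewrite !mxE.
have Wau : Wa *m u = 0.
  (* Row [j] of [Wa] gives [squeezing G j - k * c = 0]; both covariances vanish in every other
     row. *)
  apply/colP => i; rewrite mulu adE aaE mxE /k.
  by case: eqP => _; rewrite ?mulr0 ?subr0// divfK// subrr.
(* As [u] is orthogonal to the rows of [Wa], its squared norm is its product with row [j] of [Wd],
   namely c - squeezing^2 / c; this is 1 / c because squeezing^2 = c^2 - 1. *)
have uu : dot u u = c^-1.
  rewrite /dot {1}/u trmxK mulmxBl -scalemxAl -!row_mul Wau linear0 scaler0 subr0.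
  rewrite mxE mulu ddE.
  have -> : (Wd *m Wa^T) j j' = (Wa *m Wd^T) j' j.
    by rewrite -[Wd *m Wa^T]trmxK trmx_mul trmxK mxE.
  rewrite adE eqxx /k mulrAC -expr2 (squeezing_sqr G1 (ltn_ord j)) -/c.
  by field.
have dotu v : dot u v = (Wd *m v) j 0 - k * (Wa *m v) j' 0.
  by rewrite /dot trmxK mulmxBl -scalemxAl -!row_mul !mxE.
pose h' x := k * tnth x j' - h x.
have mh' : measurable_fun setT h'.
  apply: measurable_funB => //; apply: measurable_funM => //; exact: measurable_tnth.
have := gaussian_prediction_error sigma0 iid Wau mh'.
rewrite uu; congr (_ <= _)%E; apply: eq_integral => t _; congr (_ ^+ 2)%:E.
rewrite -mul_usub_mx -mul_dsub_mx -/Wd -/Wa dotu /h' tnth_mktuple; ring.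
Qed.

Lemma decoding_error (f : (2 * M).-tuple R -> (2 * N).-tuple R) :
  measurable_fun setT f ->
  ((\sum_(i < N) (2 * sigma ^+ 2) / (2 * G i - 1))%:E <=
   \int[P]_t (\sum_(j < 2 * N) (usubmx (W *m xi t) j 0 -
     tnth (f (tuple_of_cV (dsubmx (W *m xi t)))) j) ^+ 2)%:E)%E.
Proof.
move=> mf.
have mfj j : measurable_fun setT (fun x => tnth (f x) j).
  exact: measurableT_comp (measurable_tnth j) mf.
under eq_integral do rewrite -sumEFin.
rewrite ge0_integral_sum//; first last.
- by move=> j t _; rewrite lee_fin sqr_ge0.
- move=> j; apply/measurable_EFinP; apply: measurable_funX; apply: measurable_funB.
    under eq_fun do rewrite -mul_usub_mx.
    exact: measurable_mulmx iid.1 j.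
  apply: measurableT_comp (mfj j) _; apply: measurable_tuple_of_cV => i.
  under eq_fun do rewrite -mul_dsub_mx.
  exact: measurable_mulmx iid.1 i.
(* The factor 2 counts the two quadratures of a mode, which share its gain. *)
have -> : \sum_(i < N) 2 * sigma ^+ 2 / (2 * G i - 1) =
    \sum_(j < 2 * N) sigma ^+ 2 / (2 * G j./2 - 1).
  rewrite -(sum_double_half N (fun i => sigma ^+ 2 / (2 * G i - 1))).
  by apply: eq_bigr => i _; rewrite -mulrA mulr_natl.
rewrite -sumEFin; apply: lee_sum => j _.
exact: (coordinate_decoding_error j (mfj j)).
Qed.

End decoding.

Theorem theorem2 (R : realType) (N M : nat) (sigma : R)
  (Senc : 'M[R]_(2 * N + 2 * M)) (Lamd : 'M[R]_(2 * N)) (Lama : 'M[R]_(2 * M))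
  (G : nat -> R)
  (d : measure_display) (T : measurableType d) (P : probability T R)
  (xi : T -> 'cV[R]_(2 * N + 2 * M))
  (f : (2 * M).-tuple R -> (2 * N).-tuple R) :
  (1 <= N)%N -> (N <= M)%N -> 0 < sigma ->
  symplectic Senc -> symplectic Lamd -> symplectic Lama ->
  (forall i, (i < N)%N -> 1 <= G i) ->
  block_mx Lamd 0 0 Lama *m invmx Senc *m (invmx Senc)^T *m (block_mx Lamd 0 0 Lama)^T
    = TG N M G *m (TG N M G)^T ->
  iid_gaussian P sigma xi ->
  measurable_fun setT f ->
  let y := fun t => block_mx Lamd 0 0 Lama *m invmx Senc *m xi t in
  let yd := fun t => usubmx (y t) in
  let ya := fun t => dsubmx (y t) in
  ((\sum_(i < N) (2 * sigma ^+ 2) / (2 * G i - 1))%:E <=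
   \int[P]_t (\sum_(j < 2 * N) (yd t j 0 - tnth (f (tuple_of_cV (ya t))) j) ^+ 2)%:E)%E.
Proof.
move=> _ NM sigma0 _ _ _ G1 covE iid mf /=.
apply: decoding_error => //.
by rewrite trmx_mul !mulmxA covE.
Qed.
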